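(* Let $H$ be a 2-partitionable hypergraph with associated partition $V(H)=X_1\cup\cdots\cup X_d$ into pairs, and let $W,Z\subseteq V(H)$ be such that $W\cap Z=\emptyset$ and $Z\cap X_i=\emptyset$ for some $X_i$. If $H'=H\backslash W/Z$ is a proper minor of $H$, then $H'$ has the König property or $W\cap X_i=\emptyset$.
   Context: A hypergraph $H$ has a finite vertex set $V(H)$ and a collection $E(H)$ of subsets of $V(H)$ (edges). A hypergraph with $|V(H)|=2d$, $d\ge 2$, is 2-partitionable if there is a partition $V(H)=X_1\cup\cdots\cup X_d$ into $d$ subsets of size two such that $|S\cap X_j|=1$ for every edge $S$ and every $j$. The contraction $H/i$ and deletion $H\backslash i$ have vertex set $V(H)\setminus\{i\}$ and edge sets $E(H/i)=\{S\setminus\{i\}:S\in E(H)\}$ and $E(H\backslash i)=\{S\in E(H): i\notin S\}$. $H\backslash W/Z$ is obtained by deleting all vertices of $W$ and contracting all vertices of $Z$ (the order is irrelevant); it is a proper minor if $W\ne\emptyset$ or $Z\neq\emptyset$. The König property for $H'$ means $\tau(H')=\nu(H')$, where $\tau$ is the minimum size of a vertex cover (a set of vertices meeting every edge) and $\nu$ is the maximum number of pairwise disjoint edges; by convention, a hypergraph having $\emptyset$ as an edge, or having no edges, has the König property. *)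

(* Defs.v *)
From mathcomp Require Import all_boot.

Set Implicit Arguments.
Unset Strict Implicit.
Unset Printing Implicit Defensive.

(* The vertex set is a subset of an ambient finType, so that a hypergraph and
   all of its minors live over the same type. *)
Record hypergraph (T : finType) := Hypergraph {
  vset : {set T};
  edges : {set {set T}};
  edges_sub : edges \subset powerset vset }.

Section Hypergraphs.
Variable T : finType.
Implicit Types (H : hypergraph T) (W Z C S : {set T}) (i j : T).

Lemma hypergraph_eq H H' : vset H = vset H' -> edges H = edges H' -> H = H'.
Proof.
case: H H' => [V E s] [V' E' s'] /= eV eE; case: _ / eV s' => s'.
by case: _ / eE s' => s'; rewrite (bool_irrelevance s s').
Qed.

Lemma contract_subproof H i :
  [set S :\ i | S in edges H] \subset powerset (vset H :\ i).
Proof.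
apply/subsetP=> _ /imsetP[S SE ->]; rewrite powersetE setSD //.
by have:= subsetP (edges_sub H) _ SE; rewrite powersetE.
Qed.

Definition contract H i : hypergraph T := Hypergraph (contract_subproof H i).

Lemma delete_subproof H i :
  [set S in edges H | i \notin S] \subset powerset (vset H :\ i).
Proof.
apply/subsetP=> S; rewrite inE powersetE subsetD1 => /andP[SE ->].
by have:= subsetP (edges_sub H) _ SE; rewrite powersetE => ->.
Qed.

Definition delete H i : hypergraph T := Hypergraph (delete_subproof H i).

(* H\W/Z for disjoint W and Z; by the three commutation lemmas below, the
   order in which the vertices are processed is irrelevant. *)
Definition minor H W Z : hypergraph T :=
  foldl contract (foldl delete H (enum W)) (enum Z).

Lemma deleteC H i j : delete (delete H i) j = delete (delete H j) i.
Proof.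
apply: hypergraph_eq; apply/setP=> S; rewrite !inE; first by rewrite andbCA.
by rewrite andbAC.
Qed.

Lemma contractC H i j : contract (contract H i) j = contract (contract H j) i.
Proof.
apply: hypergraph_eq => /=; first by rewrite !setDDl setUC.
rewrite -!imset_comp; apply: eq_imset => S /=.
by rewrite !setDDl setUC.
Qed.

Lemma delete_contractC H i j : i != j ->
  contract (delete H i) j = delete (contract H j) i.
Proof.
move=> ij; apply: hypergraph_eq => /=; first by rewrite !setDDl setUC.
apply/setP=> S; rewrite inE; apply/imsetP/andP.
  case=> S'; rewrite inE => /andP[S'E iS'] ->.
  by split; [apply: imset_f | rewrite !inE (negPf iS') andbF].
case=> /imsetP[S' S'E ->]; rewrite !inE ij /= => iS'.
by exists S'; rewrite // inE S'E.
Qed.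

Definition vertex_cover H C : bool :=
  (C \subset vset H) && [forall S in edges H, S :&: C != set0].

(* The whole vertex set is a cover unless the empty set is an edge; in that
   case there is no cover and the value is irrelevant, see [konig]. *)
Definition tau H : nat := #|[arg min_(C < vset H | vertex_cover H C) #|C|]|.

Definition matching H (M : {set {set T}}) : bool :=
  (M \subset edges H) && trivIset M.

Definition nu H : nat := \max_(M : {set {set T}} | matching H M) #|M|.

Definition konig H : Prop :=
  [\/ set0 \in edges H, edges H = set0 | tau H = nu H].

Definition pair_partition H (d : nat) (X : 'I_d -> {set T}) : Prop :=
  [/\ \bigcup_(j < d) X j = vset H,
      forall j k : 'I_d, j != k -> [disjoint X j & X k],
      forall j : 'I_d, #|X j| = 2
    & forall (S : {set T}) (j : 'I_d), S \in edges H -> #|S :&: X j| = 1].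

(* [two_partitionable_by H X]: H is 2-partitionable, with associated partition
   X_1, ..., X_d. *)
Definition two_partitionable_by H (d : nat) (X : 'I_d -> {set T}) : Prop :=
  [/\ 2 <= d, #|vset H| = 2 * d & pair_partition H X].

End Hypergraphs.

(* Main.v *)
Require Import Defs.
From mathcomp Require Import all_boot.

(* An edge of H that avoids a deleted vertex w of X_i = {w, x} must contain x,
   and x survives the contractions because Z misses X_i.  So all edges of the
   minor share the vertex x, whence tau = nu = 1 unless there are no edges. *)

Lemma edges_deletes (T : finType) (H : hypergraph T) (s : seq T) :
  edges (foldl (@delete T) H s) = [set S in edges H | ~~ has [in S] s].
Proof.
elim: s H => [|i s IHs] H /=; first by apply/setP=> S; rewrite inE andbT.
by rewrite IHs; apply/setP=> S; rewrite !inE negb_or andbA.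
Qed.

Lemma edges_contracts (T : finType) (H : hypergraph T) (s : seq T) :
  edges (foldl (@contract T) H s) = [set S :\: [set:: s] | S in edges H].
Proof.
elim: s H => [|i s IHs] H /=.
  rewrite -[LHS]imset_id; apply: eq_imset => S.
  by apply/setP=> y; rewrite !inE.
rewrite IHs -imset_comp; apply: eq_imset => S.
by apply/setP=> y; rewrite !inE negb_or andbCA andbA.
Qed.

(** As [minor] deletes before it contracts, avoidance of [W] is tested on the original edge [S],
    before [Z] is removed from it. *)
Lemma edges_minor (T : finType) (H : hypergraph T) (W Z : {set T}) :
  edges (minor H W Z) =
  [set S :\: Z | S in [set S in edges H | [disjoint W & S]]].
Proof.
rewrite /minor edges_contracts edges_deletes set_enum.
suff -> : [set S in edges H | ~~ has [in S] (enum W)] =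
          [set S in edges H | [disjoint W & S]] by [].
by apply/setP=> S; rewrite !inE -disjoint_has (eq_disjoint (mem_enum W)).
Qed.

(** Once some edge [S0] exists, [[set x]] is a cover and [[set S0]] a matching; neither can be
    improved on. *)
Lemma konig_common_vertex (T : finType) (H : hypergraph T) (x : T) :
  (forall S, S \in edges H -> x \in S) -> konig H.
Proof.
move=> xE; have [E0|/set0Pn[S0 S0E]] := eqVneq (edges H) set0.
  exact: Or32.
have sub S : S \in edges H -> S \subset vset H.
  by move/(subsetP (edges_sub H)); rewrite powersetE.
(* The default value of the arg min in [tau] must itself be a cover before [arg_minnP] applies. *)
have coverV : vertex_cover H (vset H).
  rewrite /vertex_cover subxx; apply/forall_inP=> S SE; apply/set0Pn.
  by exists x; rewrite inE xE // (subsetP (sub S SE)) ?xE.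
have cover_x : vertex_cover H [set x].
  rewrite /vertex_cover sub1set (subsetP (sub _ S0E)) ?xE //=.
  by apply/forall_inP=> S SE; apply/set0Pn; exists x; rewrite !inE xE /=.
apply: Or33; transitivity 1.
  rewrite /tau; case: arg_minnP => // C /andP[_ /forall_inP coverC] minC.
  (* Minimality against [[set x]] bounds the size of [C] by 1; [C] is nonempty because it meets
     [S0]. *)
  apply/eqP; rewrite eqn_leq -{1}(cards1 x) minC // card_gt0.
  by have /set0Pn[y /setIP[_ yC]] := coverC _ S0E; apply/set0Pn; exists y.
apply/eqP; rewrite eqn_leq; apply/andP; split.
  rewrite -(cards1 S0) /nu.
  apply: (@leq_bigmax_cond _ _ (fun M : {set {set T}} => #|M|) [set S0]).
  rewrite /matching sub1set S0E; apply/trivIsetP=> A B.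
  by rewrite !inE => /eqP-> /eqP->; rewrite eqxx.
apply/bigmax_leqP=> M /andP[/subsetP ME /trivIsetP trivM].
(* Distinct members of a matching would be disjoint, yet both contain [x]. *)
apply/card_le1_eqP=> A B AM BM; apply: contraTeq isT => AB.
by have /disjointFr/(_ (xE _ (ME _ BM))) := trivM _ _ BM AM AB; rewrite xE ?ME.
Qed.

Theorem proposition3p3 (T : finType) (H : hypergraph T) (d : nat)
    (X : 'I_d -> {set T}) (W Z : {set T}) (i : 'I_d) :
  two_partitionable_by H X ->
  W \subset vset H -> Z \subset vset H ->
  W :&: Z = set0 ->
  Z :&: X i = set0 ->
  W != set0 \/ Z != set0 ->
  konig (minor H W Z) \/ W :&: X i = set0.
Proof.
move=> [_ _ [_ _ X2 SX1]] _ _ _ ZX _.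
have [|/set0Pn[w /setIP[wW wX]]] := eqVneq (W :&: X i) set0; first by right.
left; have /cards1P[x Xw] : #|X i :\ w| == 1.
  by have := X2 i; rewrite (cardsD1 w) wX => -[] /eqP.
have xX : x \in X i by have := set11 x; rewrite -Xw => /setD1P[].
have xZ : x \notin Z.
  by apply/negP=> xZ; have := in_set0 x; rewrite -ZX inE xZ xX.
apply: (@konig_common_vertex _ _ x) => S'; rewrite edges_minor.
case/imsetP=> S; rewrite inE => /andP[SE WS] ->; rewrite inE xZ.
(* It remains to see that [x] lies in [S]. The only vertex [y] of [S] in [X i] is not [w], since [S]
   avoids [W]; hence [y] is [x]. *)
have /eqP/cards1P[y Sy] := SX1 S i SE.
have /setIP[yS yX] : y \in S :&: X i by rewrite Sy set11.
have : y \in X i :\ w.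
  by rewrite !inE yX andbT; apply: contraTneq yS => ->; rewrite (disjointFr WS).
by rewrite Xw inE => /eqP <-.
Qed.
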